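(* Let $d$ be a positive integer, let $1<p\leqslant 2$, let $0<\varepsilon\leqslant1$, let $k\geqslant d$ be an integer, and set \[ \beta=\beta(p,\varepsilon)\coloneqq\Big(\frac{\varepsilon}{10}\Big)^{\frac{10}{p-1}},\qquad \ell=\ell(p,\varepsilon,k)\coloneqq\Big\lceil\frac{4}{\varepsilon^4(p-1)}\,k\Big\rceil. \] Let $n\geqslant\ell$ be an integer and let $\boldsymbol{X}$ be a $(\beta,\ell)$-dissociated, $d$-dimensional random array on $[n]$ whose entries take values in a measurable space $\mathcal{X}$. Then for every measurable function $f\colon\mathcal{X}^{\binom{[n]}{d}}\to\mathbb{R}$ with $\mathbb{E}[f(\boldsymbol{X})]=0$ and $\|f(\boldsymbol{X})\|_{L_p}=1$ there exists an interval $I$ of $[n]$ with $|I|=k$ such that for every $J\subseteq I$ with $|J|\geqslant d$, \[ \mathbb{P}\big(\big|\mathbb{E}[f(\boldsymbol{X})\,|\,\mathcal{F}_J]\big|\leqslant\varepsilon\big)\geqslant1-\varepsilon. \]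
   Context: $[n]=\{1,\dots,n\}$, $\binom{I}{d}$ is the set of $d$-element subsets of $I$. A $d$-dimensional random array on $[n]$ is a stochastic process $\boldsymbol{X}=\langle X_s:s\in\binom{[n]}{d}\rangle$; for $J\subseteq[n]$ with $|J|\geqslant d$, $\mathcal{F}_J=\sigma(\{X_s:s\in\binom{J}{d}\})$. For integers $n\geqslant\ell\geqslant 2d$ and $0\leqslant\beta\leqslant1$, $\boldsymbol{X}$ is $(\beta,\ell)$-dissociated if for every $J,K\subseteq[n]$ with $|J|,|K|\geqslant d$, $|J|+|K|\leqslant\ell$ and $\max(J)<\min(K)$, and all events $A\in\mathcal{F}_J$, $B\in\mathcal{F}_K$, we have $|\mathbb{P}(A\cap B)-\mathbb{P}(A)\mathbb{P}(B)|\leqslant\beta$. An interval of $[n]$ is a set of consecutive integers. *)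

(* Defs.v *)
From HB Require Import structures.
From mathcomp Require Import all_boot all_order all_algebra.
From mathcomp Require Import all_classical all_reals all_analysis.
Set Implicit Arguments. Unset Strict Implicit. Unset Printing Implicit Defensive.
Import Order.TTheory GRing.Theory Num.Theory.
Local Open Scope classical_set_scope.
Local Open Scope ring_scope.

(* [n] is represented by 'I_n = {0,...,n-1}; d-element subsets of [n]. *)
Definition dsub (n dd : nat) := {s : {set 'I_n} | #|s| == dd}.

Definition prod_sigma (I : Type) dT (T : measurableType dT) : set_system (I -> T) :=
  <<s [set E | exists i (A : set T), measurable A /\ E = (fun x => x i) @^-1` A] >>.

Definition prod_measurable (I : Type) dT (T : measurableType dT) (R : realType)
  (f : (I -> T) -> R) : Prop :=
  forall B : set R, measurable B -> @prod_sigma I dT T (f @^-1` B).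

Definition sigmaF (n dd : nat) dO (O : measurableType dO) dT (T : measurableType dT)
  (X : dsub n dd -> O -> T) (J : {set 'I_n}) : set_system O :=
  <<s [set E | exists (s : dsub n dd) (A : set T),
        (val s \subset J) /\ measurable A /\ E = X s @^-1` A] >>.

Definition cond_exp_version dO (O : measurableType dO) (R : realType)
  (P : probability O R) (G : set_system O) (Y Z : O -> R) : Prop :=
  (forall B : set R, measurable B -> G (Z @^-1` B)) /\
  P.-integrable setT (EFin \o Z) /\
  (forall A, G A -> (\int[P]_(x in A) (Z x)%:E = \int[P]_(x in A) (Y x)%:E)%E).

Definition dissociated (n dd : nat) dO (O : measurableType dO) (R : realType)
  (P : probability O R) dT (T : measurableType dT)
  (X : dsub n dd -> O -> T) (beta : R) (l : nat) : Prop :=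
  forall J K : {set 'I_n},
    (dd <= #|J|)%N -> (dd <= #|K|)%N -> (#|J| + #|K| <= l)%N ->
    (forall j k, j \in J -> k \in K -> (j < k)%N) ->
    forall A B, sigmaF X J A -> sigmaF X K B ->
      (`| P (A `&` B) - P A * P B | <= beta%:E)%E.

Definition interval_of_n (n : nat) (I : {set 'I_n}) : Prop :=
  exists a : nat, I = finset (fun i : 'I_n => (a <= i < a + #|I|)%N).

(* Main.v *)
Require Import Defs.
From HB Require Import structures.
From mathcomp Require Import all_boot all_order all_algebra.
From mathcomp Require Import all_classical all_reals all_analysis.
From mathcomp Require Import measurable_realfun ring lra zify.
Import Order.TTheory GRing.Theory Num.Theory.
Local Open Scope classical_set_scope.
Local Open Scope ring_scope.

(* Argue by duality, without conditional expectations of the whole process.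
   Put q = p/(p-1), z = q - 1 = 1/(p-1) and m = l %/ k, and cut [n] into blocks of length k.
   If the i-th block fails with a version Z_i, then E Z_i = 0 and A_i = {Z_i > 0} satisfies
   E[f 1_{A_i}] = E|Z_i| / 2 > eps^2 / 2. Hence S = sum_(i < m) (1_{A_i} - P A_i) has
   E[f S] > L := m eps^2 / 2, so that ||S||_q > L by Hoelder.
   On the other hand the A_i are almost independent, and ||S||_q <= L: the conditional law of
   the next increment given N_i = sum_(j < i) 1_{A_j} is nearly a centred two-point law, for
   which the potential (b + x^2)^(q/2) does not increase on average when b drops by z/2.
   Since N_i takes only i + 1 values (not 2^i patterns), the total dissociation error is
   polynomial in m and is absorbed by beta = (eps/10)^(10 z). *)

(** * Inequalities for real powers *)

Lemma powR_le_tangent (R : realType) (t a : R) :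
  0 <= t -> 0 <= a <= 1 -> t `^ a <= 1 + a * (t - 1).
Proof.
move=> t0 /andP[a0 a1].
have [->|an0] := eqVneq a 0; first by rewrite powRr0 mul0r addr0.
have [->|an1] := eqVneq a 1; first by rewrite powRr1// mul1r addrC subrK.
have a_gt0 : 0 < a by rewrite lt0r an0.
have a_lt1 : 0 < 1 - a by rewrite subr_gt0 lt_neqAle an1.
have := @conjugate_powR R (t `^ a) 1 a^-1 (1 - a)^-1 (powR_ge0 _ _) ler01.
rewrite !invr_gt0 a_gt0 a_lt1 !invrK => /(_ isT isT (subrKC _ _)).
rewrite -powRrM mulfV// powRr1// powR1 mulr1; lra.
Qed.

(** Bernoulli's inequality, by inverting the concave case: [powR_le_tangent] with exponent 1/r
    bounds the r-th root of 1 + r (t - 1) by t. *)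
Lemma tangent_le_powR (R : realType) (t r : R) :
  0 <= t -> 1 <= r -> 1 + r * (t - 1) <= t `^ r.
Proof.
move=> t0 r1; have r0 : 0 < r by lra.
have [w0|/ltW w0] := leP (1 + r * (t - 1)) 0; first exact: le_trans (powR_ge0 _ _).
have rV : 0 <= r^-1 <= 1 by rewrite invr_ge0 (ltW r0) invf_le1.
have := @powR_le_tangent R _ r^-1 w0 rV.
have -> : 1 + r^-1 * (1 + r * (t - 1) - 1) = t by field; rewrite gt_eqF.
move=> h.
have := @ge0_ler_powR R r (ltW r0) _ _ _ _ h.
rewrite !nnegrE powR_ge0 => /(_ isT t0).
by rewrite -powRrM mulVf ?gt_eqF// powRr1.
Qed.

(** A mean value bound without derivatives: by convexity the graph lies above its tangent at the
    larger of the two points, whose slope is at most r w^(r-1). *)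
Lemma powR_sub_le (R : realType) (s t w r : R) :
  0 <= s <= w -> 0 <= t <= w -> 0 < w -> 1 <= r ->
  `|s `^ r - t `^ r| <= r * w `^ (r - 1) * `|s - t|.
Proof.
move=> + + w0 r1.
suff H a b : 0 <= a <= w -> 0 <= b <= w -> a `^ r - b `^ r <= r * w `^ (r - 1) * `|a - b|.
  by move=> s0 t0; rewrite ler_norml H// andbT lerNl opprB distrC H.
move=> /andP[a0 aw] /andP[b0 bw].
have [ab|ba] := leP a b.
  apply: (@le_trans _ _ 0); last by rewrite !mulr_ge0// ?powR_ge0//; lra.
  by rewrite subr_le0 ge0_ler_powR ?nnegrE//; lra.
have a_gt0 : 0 < a by lra.
have ar : 0 < a `^ (r - 1) by rewrite powR_gt0.
have E : a `^ r = a `^ (r - 1) * a by rewrite mulrC mulr_powRB1//; lra.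
have := @tangent_le_powR R (b / a) r (divr_ge0 b0 a0) r1.
have aV : a^-1 `^ r = (a `^ r)^-1 by rewrite -[a^-1]powR_inv1// -powRrM mulN1r powRN.
rewrite powRM ?invr_ge0// aV ler_pdivlMr ?powR_gt0// E => h.
rewrite (ger0_norm (_ : 0 <= a - b)); last lra.
apply: (@le_trans _ _ (r * a `^ (r - 1) * (a - b))).
  have : (1 + r * (b / a - 1)) * (a `^ (r - 1) * a) =
     a `^ (r - 1) * a - r * a `^ (r - 1) * (a - b) by field; rewrite gt_eqF.
  lra.
apply: ler_wpM2r; first lra.
apply: ler_wpM2l; first lra.
by rewrite ge0_ler_powR ?nnegrE//; lra.
Qed.

(* Multiplying the bound for r by 1 + u gives the bound for r + 1 exactly when (r - 1) u <= 1,
   which reduces everything to Bernoulli's inequality with exponent r - 1 in [0, 1]. *)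
Lemma powR_1D_le_quadratic (R : realType) (r u : R) :
  1 <= r -> -1 < u -> (r - 2) * u <= 1 ->
  (1 + u) `^ r <= 1 + r * u + r * (r - 1) * u ^+ 2.
Proof.
move=> r1 u1.
have base r' : 1 <= r' -> r' <= 2 ->
    (1 + u) `^ r' <= 1 + r' * u + r' * (r' - 1) * u ^+ 2.
  move=> r'1 r'2.
  have := @powR_le_tangent R (1 + u) (r' - 1); rewrite -(@mulr_powRB1 _ (1 + u) r'); [|lra..].
  move=> /(_ _ _)/(ler_wpM2l (_ : 0 <= 1 + u)) h.
  apply: (le_trans (h _ _ _)); [lra..|].
  have : 0 <= (r' - 1) ^+ 2 * u ^+ 2 by rewrite mulr_ge0 ?sqr_ge0.
  nra.
have [n] : exists n : nat, r <= 2 + n%:R.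
  exists (Num.trunc r).+1; have := truncnS_gt r; lra.
elim: n r r1 => [|n IH] r r1 rn ru; first by apply: base => //; rewrite mulr0n in rn; lra.
have [r2|r2] := leP r 2; first exact: base.
(* The side condition passes from r to r - 1: for u < 0 the product (r - 3) u is nonpositive if r >=
   3, and below 1 if 2 < r < 3 because u > -1. *)
have h : (r - 1 - 2) * u <= 1.
  have [u0|u0] := leP 0 u; [nra|].
  have [r3|r3] := leP 3 r; nra.
have := IH (r - 1) _ _ h; rewrite -(@mulr_powRB1 _ (1 + u) r); [|lra..].
move=> /(_ _ _)/(ler_wpM2l (_ : 0 <= 1 + u)) {}h.
apply: (le_trans (h _ _ _)); [lra| |lra|].
  by move: rn; rewrite -natr1; lra.
have : 0 <= (r - 1) * u ^+ 2 * (1 - (r - 2) * u).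
  by apply: mulr_ge0; [apply: mulr_ge0; [lra|exact: sqr_ge0]|lra].
nra.
Qed.

(** Expand both powers to second order around s = b + x^2. The increments 2xh + h^2, for h = -a and
    h = 1 - a, have mean v = a(1 - a), the linear parts cancelling, and second moment Q. It suffices
    that v s + (r - 1) Q <= (z/2) s; Bernoulli then turns 1 + r z/(2s) back into a power. *)
Lemma two_point_le (R : realType) (z b a x : R) :
  1 <= z -> z ^+ 2 / 4 <= b -> 0 <= a <= 1 ->
  (1 - a) * (b + (x - a) ^+ 2) `^ ((z + 1) / 2) +
    a * (b + (x + 1 - a) ^+ 2) `^ ((z + 1) / 2)
  <= (b + z / 2 + x ^+ 2) `^ ((z + 1) / 2).
Proof.
move=> z1 zb /andP[a0 a1]; set r := (z + 1) / 2.
have r1 : 1 <= r by rewrite /r; lra.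
have rz : r = (z + 1) / 2 by [].
clearbody r.
have z2 : 1 <= z ^+ 2 by rewrite expr_ge1//; lra.
have b0 : 0 < b by lra.
have x20 : 0 <= x ^+ 2 by exact: sqr_ge0.
set s := b + x ^+ 2.
have s0 : 0 < s by rewrite /s; lra.
have sr : 0 < s `^ r by rewrite powR_gt0.
have step h : -1 <= h <= 1 ->
    (b + (x + h) ^+ 2) `^ r <=
    s `^ r * (1 + r * ((2 * x * h + h ^+ 2) / s) +
              r * (r - 1) * ((2 * x * h + h ^+ 2) / s) ^+ 2).
  move=> /andP[h1 h2]; set u := (2 * x * h + h ^+ 2) / s.
  have us : u * s = 2 * x * h + h ^+ 2 by rewrite /u divfK// gt_eqF.
  have -> : b + (x + h) ^+ 2 = s * (1 + u) by rewrite mulrDr mulr1 (mulrC s) us /s; ring.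
  have u1 : -1 < u.
    rewrite -subr_gt0 opprK -(pmulr_lgt0 _ s0) mulrDl us /s mul1r.
    have := sqr_ge0 (x + h); nra.
  rewrite powRM; [|lra..].
  rewrite ler_pM2l//; apply: powR_1D_le_quadratic => //.
  rewrite -(ler_pM2r s0) -mulrA us mul1r.
  have xh : 0 <= x ^+ 2 + (2 * x * h + h ^+ 2) by have := sqr_ge0 (x + h); nra.
  have [r2|r2] := leP r 2.
    have : 0 <= (2 - r) * (x ^+ 2 + (2 * x * h + h ^+ 2)) by rewrite mulr_ge0//; lra.
    have : 0 <= (r - 1) * x ^+ 2 by rewrite mulr_ge0//; lra.
    rewrite /s; nra.
  have h2' : h ^+ 2 <= 1 by nra.
  (* This square gives (r - 2)(2xh + h^2) <= x^2 + (r - 2)(r - 1) h^2 <= x^2 + z^2/4 <= s, which is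
     the side condition (r - 2) u <= 1. *)
  have := sqr_ge0 (x - (r - 2) * h) => q1.
  have q2 : 0 <= (r - 2) * (r - 1) * (1 - h ^+ 2).
    by apply: mulr_ge0; [apply: mulr_ge0|]; lra.
  have q3 : (r - 2) * (r - 1) <= z ^+ 2 / 4 by rewrite rz; lra.
  rewrite /s; nra.
set v := a * (1 - a).
set Q := (1 - a) * (2 * x * - a + (- a) ^+ 2) ^+ 2 +
         a * (2 * x * (1 - a) + (1 - a) ^+ 2) ^+ 2.
have v0 : 0 <= v by rewrite mulr_ge0//; lra.
have v4 : v <= 1 / 4 by have := sqr_ge0 (a - 1 / 2); rewrite /v; nra.
have QE : Q = v * (4 * x ^+ 2 + 4 * x * (1 - 2 * a) + (1 - 3 * v)) by rewrite /Q /v; ring.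
have Qle : Q <= (`|x| + 1 / 2) ^+ 2.
  have xa : x * (1 - 2 * a) <= `|x|.
    rewrite (le_trans (ler_norm _))// normrM ler_piMr// ler_norml; lra.
  have : 0 <= (1 / 4 - v) * (4 * x ^+ 2 + 4 * `|x| + 1).
    by apply: mulr_ge0; [lra|]; have := normr_ge0 x; lra.
  have : 0 <= v * (`|x| - x * (1 - 2 * a)) by apply: mulr_ge0 => //; lra.
  have : `|x| ^+ 2 = x ^+ 2 by rewrite real_normK ?num_real.
  rewrite QE; nra.
(* With v <= 1/4, the bound on Q and b >= z^2/4, completing the square at |x| = z - 1 leaves exactly
   1/16 of the cubic in [p5]. *)
have main : v * s + (r - 1) * Q <= z / 2 * s.
  have p1 : 0 <= (1 / 4 - v) * s by apply: mulr_ge0; lra.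
  have p2 : 0 <= (r - 1) * ((`|x| + 1 / 2) ^+ 2 - Q) by apply: mulr_ge0; lra.
  have p3 : 0 <= (z / 2 - 1 / 4) * (b - z ^+ 2 / 4) by apply: mulr_ge0; lra.
  have p4 := sqr_ge0 (`|x| - (z - 1)).
  have p5 : 0 <= 2 * z ^+ 3 - 5 * z ^+ 2 + 6 * z - 2.
    have : 0 <= (z - 1) ^+ 3 by apply: exprn_ge0; lra.
    have := sqr_ge0 (z - 1); nra.
  have p6 : `|x| ^+ 2 = x ^+ 2 by rewrite real_normK ?num_real.
  rewrite rz in p2 *; rewrite /s in p1 *; nra.
have le1 := ler_wpM2l (_ : 0 <= 1 - a) (step (- a) _).
have le2 := ler_wpM2l a0 (step (1 - a) _).
apply: (@le_trans _ _ (s `^ r * (1 + r * (z / 2 / s)))).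
  have -> : x + 1 - a = x + (1 - a) by ring.
  apply: (le_trans (lerD (le1 _ _) (le2 _))); [lra..|].
  have -> : (1 - a) *
    (s `^ r *
     (1 + r * ((2 * x * - a + (- a) ^+ 2) / s) +
      r * (r - 1) * ((2 * x * - a + (- a) ^+ 2) / s) ^+ 2)) +
   a *
    (s `^ r *
     (1 + r * ((2 * x * (1 - a) + (1 - a) ^+ 2) / s) +
      r * (r - 1) * ((2 * x * (1 - a) + (1 - a) ^+ 2) / s) ^+ 2)) =
    s `^ r * (1 + r * ((v * s + (r - 1) * Q) / s ^+ 2)).
    by rewrite /Q /v; field; rewrite gt_eqF.
  rewrite ler_pM2l// lerD2l ler_wpM2l//; first lra.
  by rewrite ler_pdivrMr ?exprn_gt0// expr2 mulrA divfK ?gt_eqF.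
have zs : 0 <= z / 2 / s by rewrite !mulr_ge0// ?invr_ge0; lra.
have -> : b + z / 2 + x ^+ 2 = s * (1 + z / 2 / s) by rewrite /s; field; rewrite gt_eqF.
rewrite powRM ?(ltW s0)//; last lra.
rewrite ler_pM2l//; have := @tangent_le_powR R (1 + z / 2 / s) r; rewrite addrAC subrr add0r.
by apply => //; lra.
Qed.

(** * Moments of the counting variable *)

Lemma powR_exprn (R : realType) (a x : R) n :
  0 <= a -> (a ^+ n) `^ x = a `^ (n%:R * x).
Proof. by move=> a0; rewrite powRrM powR_mulrn. Qed.

(** This is the factor by which a dissociation error gets multiplied. With r = (z + 1)/2, the power
    r has Lipschitz constant r W^(z-1) on [0, W^2], and the argument moves by |2y + 1| <= 2W. *)
Lemma increment_le (R : realType) (z b W y M : R) :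
  1 <= z -> 0 <= b -> 0 < M -> M <= W -> b + M ^+ 2 <= W ^+ 2 ->
  `|y| <= M -> `|y + 1| <= M ->
  `|(b + (y + 1) ^+ 2) `^ ((z + 1) / 2) - (b + y ^+ 2) `^ ((z + 1) / 2)|
  <= (z + 1) * W `^ z.
Proof.
move=> z1 b0 M0 MW bM yM y1M; set r := (z + 1) / 2.
have W0 : 0 < W by lra.
have sq t : `|t| <= M -> 0 <= b + t ^+ 2 <= W ^+ 2.
  move=> tM; have := sqr_ge0 t.
  have : `|t| ^+ 2 <= M ^+ 2 by rewrite lerXn2r ?nnegrE// ltW.
  rewrite real_normK ?num_real//; lra.
apply: le_trans (powR_sub_le _ _ _ (W ^+ 2) _ _ _ _ _) _.
- exact: (sq (y + 1)).
- exact: sq.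
- by rewrite exprn_gt0.
- by rewrite /r; lra.
have -> : b + (y + 1) ^+ 2 - (b + y ^+ 2) = y + (y + 1) by ring.
have h : `|y + (y + 1)| <= 2 * W.
  by rewrite (le_trans (ler_normD _ _))//; lra.
have Wz : (W ^+ 2) `^ (r - 1) * W = W `^ z.
  rewrite powR_exprn ?(ltW W0)// -{2}(@powRr1 _ W (ltW W0)).
  rewrite -powRD; last by rewrite (gt_eqF W0) implybT.
  by congr (_ `^ _); rewrite /r; field.
apply: (le_trans (ler_wpM2l _ h)).
  by rewrite mulr_ge0 ?powR_ge0// /r; lra.
by rewrite -Wz /r le_eqVlt; apply/orP; left; apply/eqP; field.
Qed.

(* Meant for a i = P(A_i), pi i v = P(N_i = v) and alpha i v = P(N_i = v, A_i), where N_i is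
   the number of events A_j, j < i, that occur; the potential at step i is
   (b_i + x^2)^((z + 1) / 2) with b_i = z^2 / 4 + (m - i) z / 2. *)
Lemma moment_recursion (R : realType) (m : nat) (z beta W : R)
    (a : nat -> R) (pi alpha : nat -> nat -> R) :
  1 <= z -> 0 <= beta -> (0 < m)%N -> m%:R <= W ->
  z ^+ 2 / 4 + m%:R * (z / 2) + m%:R ^+ 2 <= W ^+ 2 ->
  (forall i, 0 <= a i <= 1) -> pi 0 0 = 1 ->
  (forall i v, 0 <= pi i v) ->
  (forall i v, (i < m)%N -> `|alpha i v - a i * pi i v| <= beta) ->
  (forall i (g : nat -> R), (i < m)%N ->
    \sum_(v < i.+2) g v * pi i.+1 v =
    \sum_(v < i.+1) (g v * (pi i v - alpha i v) + g v.+1 * alpha i v)) ->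
  \sum_(v < m.+1) ((v%:R - \sum_(j < m) a j) ^+ 2) `^ ((z + 1) / 2) * pi m v
  <= (z ^+ 2 / 4 + m%:R * (z / 2)) `^ ((z + 1) / 2) +
     m%:R * (m%:R * (beta * ((z + 1) * W `^ z))).
Proof.
move=> z1 beta0 m0 mW BW a01 pi00 pi_ge0 Hdec Hrec.
set r := (z + 1) / 2; set B := z ^+ 2 / 4 + m%:R * (z / 2).
set e := m%:R * (beta * ((z + 1) * W `^ z)).
have r1 : 1 <= r by rewrite /r; lra.
have mR : 1 <= m%:R :> R by rewrite ler1n.
have e0 : 0 <= e by rewrite !mulr_ge0 ?powR_ge0//; lra.
pose c i := \sum_(j < i) a j.
have c_bnd i : 0 <= c i <= i%:R.
  rewrite sumr_ge0 => [|j _]; last by have /andP[] := a01 j.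
  rewrite -[i in i%:R]card_ord -sumr_const ler_sum// => j _.
  by have /andP[] := a01 j.
pose b i := z ^+ 2 / 4 + (m%:R - i%:R) * (z / 2).
(* The mean potential starts at B^r and grows by at most e per step; at i = m the remaining b_m =
   z^2/4 >= 0 is dropped. *)
suff H i : (i <= m)%N ->
    \sum_(v < i.+1) (b i + (v%:R - c i) ^+ 2) `^ r * pi i v <= B `^ r + i%:R * e.
  apply: le_trans (H m (leqnn _)); apply: ler_sum => v _.
  apply: ler_wpM2r; first exact: pi_ge0.
  have := sqr_ge0 (v%:R - c m); have := sqr_ge0 z => z2 v2.
  rewrite /b subrr mul0r addr0 -/(c m).
  by apply: ge0_ler_powR; rewrite ?nnegrE; lra.
elim: i => [_|i IH im].
  by rewrite big_ord1 /c big_ord0 pi00 /b !subr0 mulr1 mul0r /= mulr0n expr0n !addr0.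
have imR : i.+1%:R <= m%:R :> R by rewrite ler_nat.
have iE : i.+1%:R = i%:R + 1 :> R by rewrite -natr1.
rewrite (Hrec i (fun v => (b i.+1 + (v%:R - c i.+1) ^+ 2) `^ r))//.
have -> : B `^ r + i.+1%:R * e = B `^ r + i%:R * e + e by rewrite iE; ring.
(* The count has only i + 1 <= m possible values, each contributing one error term. *)
have le_e : \sum_(v < i.+1) beta * ((z + 1) * W `^ z) <= e.
  rewrite sumr_const card_ord -mulr_natl /e ler_wpM2r//.
  by rewrite !mulr_ge0 ?powR_ge0//; lra.
apply: le_trans (lerD (IH (ltnW im)) le_e).
rewrite -big_split/=; apply: ler_sum => -[v /= vi] _.
have cE : c i.+1 = c i + a i by rewrite /c big_ord_recr.
have vR : v%:R <= i%:R :> R by rewrite ler_nat -ltnS.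
have v0 : 0 <= v%:R :> R by [].
have /andP[c0 ci] := c_bnd i; have /andP[a0 a1] := a01 i.
set x := v%:R - c i.
have -> : v%:R - c i.+1 = x - a i by rewrite cE /x; ring.
have -> : v.+1%:R - c i.+1 = x + 1 - a i by rewrite cE /x -natr1; ring.
have zb : z ^+ 2 / 4 <= b i.+1 by rewrite /b lerDl mulr_ge0//; lra.
have bE : b i = b i.+1 + z / 2 by rewrite /b iE; ring.
have b0 : 0 <= b i.+1 by have := sqr_ge0 z; lra.
have tp := two_point_le _ _ _ _ x z1 zb (a01 i).
have inc : `|(b i.+1 + (x + 1 - a i) ^+ 2) `^ r - (b i.+1 + (x - a i) ^+ 2) `^ r|
    <= (z + 1) * W `^ z.
  have -> : x + 1 - a i = x - a i + 1 by ring.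
  apply: (@increment_le _ _ _ _ _ m%:R) => //; first lra.
  - have : 0 <= i.+1%:R * (z / 2) by rewrite mulr_ge0//; lra.
    rewrite /b; lra.
  - by rewrite ler_norml /x; lra.
  - by rewrite ler_norml /x; lra.
move: tp inc; rewrite -bE -/r.
set F0 := (b i.+1 + (x - a i) ^+ 2) `^ r; set F1 := (_ + (x + 1 - a i) ^+ 2) `^ r.
move=> tp inc.
(* Split into the independent case, handled by [two_point_le], and the covariance times the
   increment of the potential. *)
have -> : F0 * (pi i v - alpha i v) + F1 * alpha i v =
  ((1 - a i) * F0 + a i * F1) * pi i v + (alpha i v - a i * pi i v) * (F1 - F0) by ring.
apply: lerD; first by rewrite ler_wpM2r.
apply: (le_trans (ler_norm _)); rewrite normrM.
by apply: ler_pM => //; exact: Hdec.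
Qed.

(** The left side is the bound of [moment_recursion] with W = 3m/2, and the right side is L^(z+1).
    The main term gets 7/9 of it and the dissociation error 2/9. *)
Lemma moment_bound_numeric (R : realType) (z eps m : R) :
  1 <= z -> 0 < eps -> eps <= 1 ->
  3 * z <= m * eps ^+ 4 -> m * eps ^+ 4 <= 5 * z ->
  (z ^+ 2 / 4 + m * (z / 2)) `^ ((z + 1) / 2) +
    m * (m * ((eps / 10) `^ (10 * z) * ((z + 1) * (3 / 2 * m) `^ z)))
  <= (m * eps ^+ 2 / 2) `^ (z + 1).
Proof.
move=> z1 e0 e1 lo hi; set L := m * eps ^+ 2 / 2; set r := (z + 1) / 2.
have e40 : 0 < eps ^+ 4 by rewrite exprn_gt0.
have e20 : 0 < eps ^+ 2 by rewrite exprn_gt0.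
have e41 : eps ^+ 4 <= 1 by rewrite exprn_ile1// ltW.
have m0 : 0 < m by rewrite -(pmulr_lgt0 _ e40); lra.
have zm : 3 * z <= m by rewrite (le_trans lo)// ler_piMr// ltW.
have L0 : 0 < L by rewrite /L; apply: divr_gt0 => //; apply: mulr_gt0.
have Lz : 0 < L `^ z by rewrite powR_gt0.
have LE : L `^ (z + 1) = L * L `^ z.
  by rewrite powRD ?(gt_eqF L0) ?implybT// powRr1 ?(ltW L0)// mulrC.
have main : (z ^+ 2 / 4 + m * (z / 2)) `^ r <= 7 / 9 * L `^ (z + 1).
  (* From m eps^4 >= 3z comes L^2 >= (3/4) m z, while m >= 3z bounds the left side by (1/12 + 1/2) m
     z; the ratio is 7/9. *)
  have L2 : z ^+ 2 / 4 + m * (z / 2) <= 7 / 9 * L ^+ 2.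
    have -> : L ^+ 2 = m * (m * eps ^+ 4) / 4 by rewrite /L; field.
    have : 0 <= m * (m * eps ^+ 4 - 3 * z) by rewrite mulr_ge0//; lra.
    have : 0 <= z * (m - 3 * z) by rewrite mulr_ge0//; lra.
    rewrite !expr2; nra.
  have r1 : 1 <= r by rewrite /r; lra.
  have q0 : 0 <= z ^+ 2 / 4 + m * (z / 2).
    by apply: addr_ge0; [have := sqr_ge0 z; lra|apply: mulr_ge0; lra].
  have := @ge0_ler_powR _ r _ _ _ _ _ L2; rewrite !nnegrE q0.
  move=> /(_ _ isT _)/le_trans; apply; [lra|rewrite mulr_ge0 ?exprn_ge0//; lra|].
  have L20 : 0 <= L ^+ 2 by rewrite exprn_ge0// ltW.
  rewrite powRM//.
  have -> : (L ^+ 2) `^ r = L `^ (z + 1).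
    by rewrite powR_exprn ?(ltW L0)//; congr (_ `^ _); rewrite /r; field.
  by apply: ler_wpM2r; [exact: powR_ge0|apply: ge1r_powR; lra].
suff err : m * (m * ((eps / 10) `^ (10 * z) * ((z + 1) * (3 / 2 * m) `^ z)))
    <= 2 / 9 * L `^ (z + 1) by lra.
pose V := eps^-1.
have V0 : 0 < V by rewrite invr_gt0.
have V1 : 1 <= V by rewrite invf_ge1.
have mE : m = 2 * L * V ^+ 2 by rewrite /L /V; field; rewrite gt_eqF.
have m5 : m <= 5 * z * V ^+ 4.
  by rewrite /V exprVn ler_pdivlMr.
have -> : (3 / 2 * m) `^ z = (3 * V ^+ 2) `^ z * L `^ z.
  rewrite -powRM; [|rewrite mulr_ge0 ?exprn_ge0//; lra|exact: ltW].
  by congr (_ `^ _); rewrite {1}mE; field.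
have -> : (eps / 10) `^ (10 * z) = ((eps / 10) ^+ 10) `^ z.
  by rewrite powR_exprn// divr_ge0// ltW.
set bz := ((eps / 10) ^+ 10) `^ z; set wz := (3 * V ^+ 2) `^ z.
have z2 : 1 + z <= 2 `^ z.
  have := @tangent_le_powR R 2 z; lra.
have V6 : V ^+ 6 <= (V ^+ 6) `^ z by rewrite le1r_powR// exprn_ege1.
(* Every factor is put under the exponent z, using z <= z + 1 <= 2^z and V >= 1; the bases then
   multiply to 12 eps^2 / 10^10. *)
have key : z * (z + 1) * V ^+ 6 * bz * wz <= 12 / 10 ^+ 10.
  apply: (@le_trans _ _ (2 `^ z * 2 `^ z * (V ^+ 6) `^ z * bz * wz)).
    rewrite !ler_wpM2r ?powR_ge0//; apply: ler_pM => //.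
    - by rewrite mulr_ge0//; lra.
    - by rewrite exprn_ge0// ltW.
    - by apply: ler_pM; lra.
  have Vge0 := ltW V0; have ege0 := ltW e0.
  rewrite /bz /wz -!powRM ?mulr_ge0 ?exprn_ge0//.
  have -> : 2 * 2 * V ^+ 6 * (eps / 10) ^+ 10 * (3 * V ^+ 2) = 12 / 10 ^+ 10 * eps ^+ 2.
    by rewrite /V; field; rewrite gt_eqF.
  have e21 : eps ^+ 2 <= 1 by rewrite exprn_ile1// ltW.
  have c0 : 0 < 12 / 10 ^+ 10 :> R by rewrite divr_gt0// exprn_gt0.
  have c1 : 12 / 10 ^+ 10 <= 1 :> R by rewrite ler_pdivrMr ?exprn_gt0// mul1r; lra.
  have h : 0 < 12 / 10 ^+ 10 * eps ^+ 2 <= 1.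
    by rewrite mulr_gt0//= mulr_ile1// ltW.
  by apply: (le_trans (ge1r_powR h z1)); rewrite ler_piMr// ltW.
have -> : m * (m * (bz * ((z + 1) * (wz * L `^ z)))) =
   m * (2 * V ^+ 2 * (bz * ((z + 1) * wz))) * (L * L `^ z) by rewrite {2}mE; ring.
have LL : 0 <= L * L `^ z by apply: mulr_ge0; exact: ltW.
rewrite LE ler_wpM2r//.
apply: (@le_trans _ _ (10 * (z * (z + 1) * V ^+ 6 * bz * wz))).
  have -> : 10 * (z * (z + 1) * V ^+ 6 * bz * wz) =
    5 * z * V ^+ 4 * (2 * V ^+ 2 * (bz * ((z + 1) * wz))) by ring.
  rewrite ler_wpM2r// !mulr_ge0 ?powR_ge0 ?exprn_ge0//; lra.
have : 12 / 10 ^+ 10 <= 1 / 100 :> R by rewrite ler_pdivrMr ?exprn_gt0//; lra.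
lra.
Qed.

(** * Integrals and hitting counts *)

Lemma integrable_mul_indic {d} {T : measurableType d} {R : realType}
    (mu : {measure set T -> \bar R}) (f : T -> R) (A : set T) :
  measurable A -> mu.-integrable setT (EFin \o f) ->
  mu.-integrable setT (EFin \o (fun x => f x * \1_A x)).
Proof.
move=> mA fi.
have -> : EFin \o (fun x => f x * \1_A x) = (EFin \o f) \_ A.
  rewrite restrict_EFin; congr (_ \o _); apply/funext => x.
  by rewrite indicE patchE; case: ifP; rewrite ?mulr1 ?mulr0.
apply/(integrable_mkcond _ mA).
exact: (integrableS measurableT mA _ fi).
Qed.

Lemma Rintegral_mul_indic {d} {T : measurableType d} {R : realType}
    (mu : {measure set T -> \bar R}) (f : T -> R) (A : set T) :
  \int[mu]_x (f x * \1_A x) = \int[mu]_(x in A) f x.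
Proof.
rewrite [RHS]Rintegral_mkcond; apply: eq_Rintegral => x _.
by rewrite indicE patchE; case: ifP; rewrite ?mulr1 ?mulr0.
Qed.

(** As Z has mean zero, its positive part carries half of E|Z|, and E|Z| >= eps P(|Z| > eps) >
    eps^2. *)
Lemma Rintegral_pos_lower {d} {T : measurableType d} {R : realType}
    (P : probability T R) (Z : T -> R) (eps : R) :
  P.-integrable setT (EFin \o Z) -> \int[P]_x Z x = 0 -> 0 < eps ->
  (P [set x | (`|Z x| <= eps)%R] < (1 - eps)%:E)%E ->
  eps ^+ 2 / 2 < \int[P]_(x in [set x | 0 < Z x]) Z x.
Proof.
move=> Zi Z0 e0 PZ.
have mZ : measurable_fun setT Z by apply/measurable_EFinP; exact: measurable_int Zi.
set A := [set x | 0 < Z x].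
have mA : measurable A.
  have -> : A = setT `&` Z @^-1` `]0, +oo[.
    by apply/seteqP; split => x /=; rewrite in_itv/= andbT // => -[].
  exact: mZ.
set B := [set x | (`|Z x| <= eps)%R].
have mB : measurable B.
  have -> : B = setT `&` Z @^-1` `[- eps, eps].
    by apply/seteqP; split => x /=; rewrite /B /= in_itv/= ler_norml // => -[].
  exact: mZ.
have ZAi := @integrable_mul_indic _ _ _ P Z A mA Zi.
have abs : \int[P]_x `|Z x| = 2 * \int[P]_(x in A) Z x.
  under eq_Rintegral => x _.
    rewrite (_ : `|Z x| = 2 * (Z x * \1_A x) - Z x).
    over.
    rewrite indicE; have [Zx|Zx] := ltP 0 (Z x).
      by rewrite mem_set// gtr0_norm// mulr1n; ring.
    by rewrite memNset ?ler0_norm// ?mulr0n; [ring|apply/negP; rewrite -leNgt].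
  rewrite RintegralB//; last by have := integrableZl measurableT 2 ZAi; exact: eq_integrable.
  by rewrite RintegralZl// Rintegral_mul_indic Z0 subr0.
have ci : P.-integrable setT (EFin \o cst eps) by exact: finite_measure_integrable_cst.
have low : \int[P]_x (cst eps x * \1_(~` B) x) <= \int[P]_x `|Z x|.
  apply: le_Rintegral => //.
  - by apply: integrable_mul_indic => //; exact: measurableC.
  - exact: (integrable_norm Zi).
  - move=> x _; rewrite indicE /=; have [Zx|Zx] := leP (`|Z x|) eps.
      by rewrite memNset ?mulr0// => /(_ Zx).
    by rewrite mem_set ?mulr1 ?(ltW Zx)//= /B /=; apply/negP; rewrite -ltNge.
rewrite Rintegral_mul_indic Rintegral_cst ?abs in low; last exact: measurableC.
have PB : fine (P (~` B)) = 1 - fine (P B).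
  by rewrite probability_setC// fineB// fin_num_measure.
have {}low : eps * fine (P (~` B)) <= 2 * \int[P]_(x in A) Z x := low.
have PB1 : fine (P B) < 1 - eps by rewrite -lte_fin fineK ?fin_num_measure.
have : eps * eps < eps * fine (P (~` B)) by rewrite ltr_pM2l// PB; lra.
rewrite expr2; lra.
Qed.

Lemma hoelder_powR {d} {T : measurableType d} {R : realType}
    (P : probability T R) (f S : T -> R) (p q t : R) :
  measurable_fun setT f -> measurable_fun setT S ->
  0 < p -> 0 < q -> p^-1 + q^-1 = 1 ->
  Lnorm P p%:E (EFin \o f) = 1%E ->
  0 <= t -> (t%:E <= \int[P]_x `|(f x * S x)%:E|)%E ->
  ((t `^ q)%:E <= \int[P]_x (`|S x| `^ q)%:E)%E.
Proof.
move=> mf mS p0 q0 pq fp t0 tf.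
have := @hoelder _ _ _ P f S p q mf mS p0 q0 pq.
rewrite fp mul1e Lnorm1 => /(le_trans tf) h.
have q1 : q != 0 by rewrite gt_eqF.
have := @powR_Lnorm _ _ _ P (EFin \o S) q q1.
have -> : (\int[P]_x `|(EFin \o S) x| `^ q = \int[P]_x (`|S x| `^ q)%:E)%E by [].
move=> <-; rewrite -poweR_EFin; apply: gt0_ler_poweR => //; first exact: ltW.
- by rewrite in_itv/= lee_fin t0 leey.
- by rewrite in_itv/= Lnorm_ge0 leey.
Qed.

(** Hoelder against the constant 1 bounds the L_1 norm by a power of the total mass. *)
Lemma integrable_Lnorm1 {d} {T : measurableType d} {R : realType}
    (P : probability T R) (f : T -> R) (p : R) :
  measurable_fun setT f -> 1 < p -> Lnorm P p%:E (EFin \o f) = 1%E ->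
  P.-integrable setT (EFin \o f).
Proof.
move=> mf p1 fp; apply/integrableP; split; first exact/measurable_EFinP.
have p0 : 0 < p by lra.
have pV : 0 < 1 - p^-1 by rewrite subr_gt0 invf_lt1.
have := @hoelder _ _ _ P f (cst 1) p (1 - p^-1)^-1 mf (measurable_cst _) p0.
rewrite invr_gt0 invrK pV => /(_ isT (subrKC _ _)).
rewrite fp mul1e Lnorm_cst1 Lnorm1 invrK.
under eq_integral => x _ do rewrite /= mulr1.
move=> /le_lt_trans; apply; apply: poweR_lty.
exact: (le_lt_trans (probability_le1 P measurableT) (ltry 1)).
Qed.

(** The count N_i of the outline; remembering only the count keeps the number of conditioning
    classes linear in i. *)
Definition hits {T : Type} (A : nat -> set T) (i : nat) (w : T) : nat :=
  \sum_(j < i) (w \in A j).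

Lemma hits_le {T : Type} (A : nat -> set T) i w : (hits A i w <= i)%N.
Proof.
rewrite -[leqRHS]card_ord -sum1_card; apply: leq_sum => j _; exact: leq_b1.
Qed.

Lemma hitsS {T : Type} (A : nat -> set T) i :
  hits A i.+1 = (fun w => hits A i w + (w \in A i))%N.
Proof. by apply/funext => w; rewrite /hits big_ord_recr. Qed.

Lemma hitsS_eq0 {T : Type} (A : nat -> set T) i :
  [set w | hits A i.+1 w = 0%N] = [set w | hits A i w = 0%N] `\` A i.
Proof.
rewrite hitsS; apply/seteqP; split => w /=.
  by move/eqP; rewrite addn_eq0 => /andP[/eqP ->]; rewrite eqb0 => /negP h; split => // /mem_set.
by move=> [-> h]; rewrite (@memNset _ (A i)).
Qed.

Lemma hitsS_eqS {T : Type} (A : nat -> set T) i v :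
  [set w | hits A i.+1 w = v.+1] =
  ([set w | hits A i w = v.+1] `\` A i) `|` ([set w | hits A i w = v] `&` A i).
Proof.
rewrite hitsS; apply/seteqP; split => w /=.
  have [wA|wA] := boolP (w \in A i).
    by rewrite addn1 => -[]; right; split => //; exact: set_mem.
  by rewrite addn0 => ->; left; split => // h; move/negP: wA; apply; exact: mem_set.
move=> [[-> h]|[-> h]]; first by rewrite (@memNset _ (A i)) ?addn0.
by rewrite (@mem_set _ (A i)) ?addn1.
Qed.

Lemma measurable_hits {d} {T : measurableType d} (A : nat -> set T) i v :
  (forall j, (j < i)%N -> measurable (A j)) -> measurable [set w | hits A i w = v].
Proof.
elim: i v => [v _|i IH v mA].
  have [->|v0] := eqVneq v 0%N.
    by rewrite (_ : [set _ | _] = setT)//; apply/seteqP; split => w //= _; rewrite /hits big_ord0.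
  rewrite (_ : [set _ | _] = set0)//; apply/seteqP; split => w //=.
  by rewrite /hits big_ord0 => /esym/eqP; rewrite (negbTE v0).
have mA' j : (j < i)%N -> measurable (A j) by move=> ji; exact/mA/ltnW.
have mAi := mA i (ltnSn i).
case: v => [|v]; first by rewrite hitsS_eq0; apply: measurableD => //; exact: IH.
rewrite hitsS_eqS; apply: measurableU; first by apply: measurableD => //; exact: IH.
by apply: measurableI => //; exact: IH.
Qed.

(** Supplies the recursion assumed by [moment_recursion]: the count either stays at v, when A_i
    fails, or moves to v + 1, when A_i occurs. *)
Lemma sum_hits_recursion {d} {T : measurableType d} {R : realType}
    (P : probability T R) (A : nat -> set T) (i : nat) (g : nat -> R) :
  (forall j, (j < i.+1)%N -> measurable (A j)) ->
  \sum_(v < i.+2) g v * fine (P [set w | hits A i.+1 w = v]) =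
  \sum_(v < i.+1)
    (g v * (fine (P [set w | hits A i w = v]) -
            fine (P ([set w | hits A i w = v] `&` A i))) +
     g v.+1 * fine (P ([set w | hits A i w = v] `&` A i))).
Proof.
move=> mA.
have mAi := mA i (ltnSn i).
have mN v : measurable [set w | hits A i w = v].
  by apply: measurable_hits => j /ltnW; exact: mA.
set pi := fun v => fine (P [set w | hits A i w = v]).
set al := fun v => fine (P ([set w | hits A i w = v] `&` A i)).
have PD v : fine (P ([set w | hits A i w = v] `\` A i)) = pi v - al v.
  have /(congr1 fine) := @measureDI _ _ _ P _ _ (mN v) mAi.
  rewrite fineD ?fin_num_measure//; [|exact: measurableD|exact: measurableI].
  by rewrite /pi /al => ->; rewrite addrK.
have P0 : fine (P [set w | hits A i.+1 w = 0%N]) = pi 0 - al 0.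
  by rewrite hitsS_eq0 PD.
have PS v : fine (P [set w | hits A i.+1 w = v.+1]) = pi v.+1 - al v.+1 + al v.
  have mD := measurableD (mN v.+1) mAi; have mI := measurableI _ _ (mN v) mAi.
  rewrite hitsS_eqS measureU//; last first.
    by apply/seteqP; split => w //= -[[_ +] [_]].
  by rewrite fineD ?fin_num_measure// PD.
(* N_i never exceeds i, so the extra top term of the longer sum vanishes. *)
have top : pi i.+1 - al i.+1 = 0.
  rewrite -PD (_ : _ `\` _ = set0) ?measure0//.
  apply/seteqP; split => w //= -[h _].
  by have := hits_le A i w; rewrite h ltnn.
rewrite big_ord_recl P0.
under eq_bigr => v _ do rewrite lift0 PS mulrDr.
rewrite big_split/= addrA big_split/=; congr (_ + _).
transitivity (\sum_(v < i.+2) g v * (pi v - al v)).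
  by rewrite [RHS]big_ord_recl; congr (_ + _); apply: eq_bigr => v _; rewrite lift0.
by rewrite big_ord_recr/= top mulr0 addr0.
Qed.

Lemma integral_hits {d} {T : measurableType d} {R : realType}
    (P : probability T R) (A : nat -> set T) (m : nat) (g : nat -> R) :
  (forall j, (j < m)%N -> measurable (A j)) -> (forall v, 0 <= g v) ->
  (\int[P]_w (g (hits A m w))%:E =
   (\sum_(v < m.+1) g v * fine (P [set w | hits A m w = v]))%:E)%E.
Proof.
move=> mA g0.
have mN v := measurable_hits A m v mA.
transitivity (\int[P]_w (\sum_(v < m.+1) (g v)%:E * (\1_[set w | hits A m w = v] w)%:E))%E.
  apply: eq_integral => w _; rewrite (bigD1 (Ordinal (hits_le A m w : _ < m.+1)%N))//=.
  rewrite indicE mem_set// mule1 big1 ?adde0// => v /eqP vw.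
  rewrite indicE memNset ?mule0//= => h; apply: vw; exact: val_inj.
rewrite ge0_integral_sum//; last 2 first.
- move=> v; apply: measurable_funeM; apply/measurable_EFinP; exact: measurable_indic.
- by move=> v w _; rewrite mule_ge0// lee_fin// indicE.
rewrite -sumEFin; apply: eq_bigr => v _.
rewrite ge0_integralZl_EFin//; last first.
  by apply/measurable_EFinP; exact: measurable_indic.
by rewrite integral_indic// setIT EFinM fineK ?fin_num_measure.
Qed.

Lemma Rintegral_mul_hits {d} {T : measurableType d} {R : realType}
    (P : probability T R) (f : T -> R) (A : nat -> set T) (i : nat) :
  (forall j, measurable (A j)) -> P.-integrable setT (EFin \o f) ->
  P.-integrable setT (EFin \o (fun x => f x * (hits A i x)%:R)) /\
  \int[P]_x (f x * (hits A i x)%:R) = \sum_(j < i) \int[P]_(x in A j) f x.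
Proof.
move=> mA fi; elim: i => [|i [IHi IHs]].
  rewrite big_ord0.
  have -> : (fun x => f x * (hits A 0 x)%:R) = cst 0.
    by apply/funext => x; rewrite /hits big_ord0 mulr0.
  by split; [exact: finite_measure_integrable_cst|rewrite Rintegral_cst// mul0r].
have fAi := integrable_mul_indic P f (A i) (mA i) fi.
have -> : (fun x => f x * (hits A i.+1 x)%:R) =
    (fun x => f x * (hits A i x)%:R + f x * \1_(A i) x).
  by apply/funext => x; rewrite hitsS natrD mulrDr indicE.
split; first by have := integrableD measurableT IHi fAi.
by rewrite RintegralD// IHs Rintegral_mul_indic big_ord_recr.
Qed.

(** The duality argument for events with no array structure: Hoelder with the conjugate exponent z +
    1 and the moment bound put E|S|^(z+1) strictly above and at most L^(z+1). *)
Lemma mixing_events_contradiction {d} {T : measurableType d} {R : realType}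
    (P : probability T R) (f : T -> R) (A : nat -> set T) (m : nat) (p eps : R) :
  1 < p -> p <= 2 -> 0 < eps -> eps <= 1 ->
  3 * (p - 1)^-1 <= m%:R * eps ^+ 4 -> m%:R * eps ^+ 4 <= 5 * (p - 1)^-1 ->
  measurable_fun setT f -> \int[P]_x f x = 0 ->
  Lnorm P p%:E (EFin \o f) = 1%E ->
  (forall i, measurable (A i)) ->
  (forall i v, (i < m)%N ->
    `|fine (P ([set w | hits A i w = v] `&` A i)) -
      fine (P (A i)) * fine (P [set w | hits A i w = v])|
    <= (eps / 10) `^ (10 / (p - 1))) ->
  (forall i, (i < m)%N -> eps ^+ 2 / 2 < \int[P]_(x in A i) f x) ->
  False.
Proof.
move=> p1 p2 e0 e1 mlo mhi mf f0 fp mA mix bad.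
set z := (p - 1)^-1 in mlo mhi *.
have z1 : 1 <= z by rewrite /z invf_ge1; lra.
have e40 : 0 < eps ^+ 4 by rewrite exprn_gt0.
have mR0 : 0 < m%:R :> R by rewrite -(pmulr_lgt0 _ e40); lra.
have m0 : (0 < m)%N by move: mR0; rewrite ltr0n.
have fi := integrable_Lnorm1 P f p mf p1 fp.
pose a i := fine (P (A i)).
have a01 i : 0 <= a i <= 1.
  rewrite /a fine_ge0//= -lee_fin fineK ?fin_num_measure//.
  exact: probability_le1.
set c := \sum_(j < m) a j.
pose S w : R := (hits A m w)%:R - c.
set L := m%:R * eps ^+ 2 / 2.
have L0 : 0 < L by rewrite /L; apply: divr_gt0 => //; apply: mulr_gt0 => //; exact: exprn_gt0.
have [fNi fN] := Rintegral_mul_hits P f A m mA fi.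
have fS : \int[P]_x (f x * S x) = \sum_(j < m) \int[P]_(x in A j) f x.
  under eq_Rintegral => x _ do rewrite /S mulrBr (mulrC _ c).
  rewrite RintegralB//; last by have := integrableZl measurableT c fi.
  by rewrite RintegralZl// f0 mulr0 subr0 fN.
have Lt : L < \int[P]_x (f x * S x).
  rewrite fS /L; have -> : m%:R * eps ^+ 2 / 2 = \sum_(j < m) (eps ^+ 2 / 2).
    by rewrite sumr_const card_ord -[RHS]mulr_natl mulrA.
  apply: ltr_sum; first by apply/hasP; exists (Ordinal m0); rewrite ?mem_index_enum.
  by move=> j _; exact: bad.
have mS : measurable_fun setT S.
  apply: measurable_funB => //; have -> : (fun w => (hits A m w)%:R : R) =
      (fun w => \sum_(j < m) \1_(A j) w).
    by apply/funext => w; rewrite /hits natr_sum; apply: eq_bigr => j _; rewrite indicE.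
  by apply: measurable_sum => j; exact: measurable_indic.
have fSi : P.-integrable setT (EFin \o (fun x => f x * S x)).
  have := integrableB measurableT fNi (integrableZl measurableT c fi).
  by apply: eq_integrable => // x _; rewrite /S /= mulrBr (mulrC _ c) EFinB EFinM.
set t := \int[P]_x (f x * S x) in Lt *.
have tS : (t%:E <= \int[P]_x `|(f x * S x)%:E|)%E.
  rewrite /t /Rintegral fineK; last exact: integrable_fin_num measurableT _ fSi.
  apply: (le_trans (lee_abs _)); apply: le_abse_integral => //.
  by case/integrableP: fSi.
have q0 : 0 < z + 1 by lra.
have pq : p^-1 + (z + 1)^-1 = 1.
  rewrite /z; field; rewrite !gt_eqF//=; lra.
have := hoelder_powR P f S p (z + 1) t mf mS _ q0 pq fp _ tS.
rewrite {1}/S.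
have [pe be] : 0 < p /\ 0 <= t by lra.
move=> /(_ pe be).
rewrite (integral_hits P A m (fun v => `|v%:R - c| `^ (z + 1)) (fun j _ => mA j)
  (fun v => powR_ge0 _ _)).
rewrite lee_fin.
apply/negP; rewrite -ltNge.
apply: (@le_lt_trans _ _ (L `^ (z + 1))); last first.
  by apply: gt0_ltr_powR => //; rewrite ?nnegrE//; lra.
apply: le_trans (moment_bound_numeric _ z eps m%:R z1 e0 e1 mlo mhi).
have -> : 10 * z = 10 / (p - 1) by [].
set beta := _ `^ (10 / (p - 1)).
pose pi i v := fine (P [set w | hits A i w = v]).
pose al i v := fine (P ([set w | hits A i w = v] `&` A i)).
have hz : forall x : R, `|x| `^ (z + 1) = (x ^+ 2) `^ ((z + 1) / 2).
  by move=> x; rewrite -real_normK ?num_real// powR_exprn//; congr (_ `^ _); field.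
under eq_bigr => v _ do rewrite hz.
(* W = 3m/2 is admissible because 3z <= m gives z^2/4 + mz/2 + m^2 <= 9m^2/4. *)
apply: (moment_recursion R m z beta (3 / 2 * m%:R) a pi al) => //.
- exact: powR_ge0.
- lra.
- have : 3 * z <= m%:R.
    by rewrite (le_trans mlo)// ler_piMr ?(ltW mR0)// exprn_ile1// ltW.
  nra.
- rewrite /pi (_ : [set _ | _] = setT) ?probability_setT//.
  by apply/seteqP; split => w //= _; rewrite /hits big_ord0.
- by move=> i v; rewrite fine_ge0.
- by move=> i g im; apply: sum_hits_recursion.
Qed.

(** * Random arrays *)

Lemma sub_sigmaF (n d : nat) {dO dT} {O : measurableType dO} {T : measurableType dT}
    (X : dsub n d -> O -> T) (J K : {set 'I_n}) :
  (J \subset K)%bool -> sigmaF X J `<=` sigmaF X K.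
Proof.
move=> JK; apply: sub_sigma_algebra2 => E [s [A [sJ AE]]].
by exists s, A; split => //; exact: fintype.subset_trans sJ JK.
Qed.

Lemma sigmaF_measurable (n d : nat) {dO dT} {O : measurableType dO} {T : measurableType dT}
    (X : dsub n d -> O -> T) (J : {set 'I_n}) :
  (forall s, measurable_fun setT (X s)) -> sigmaF X J `<=` measurable.
Proof.
move=> mX; apply: smallest_sub; first exact: sigma_algebra_measurable.
by move=> E [s [A [_ [mA ->]]]]; rewrite -[_ @^-1` _]setTI; exact: mX.
Qed.

(** This is [measurable_hits] read in O equipped with the generated sigma-algebra [sigmaF X J]. *)
Lemma sigmaF_hits (n d : nat) {dO dT} {O : measurableType dO} {T : measurableType dT}
    (X : dsub n d -> O -> T) (J : {set 'I_n}) (A : nat -> set O) i v :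
  (forall j, (j < i)%N -> sigmaF X J (A j)) -> sigmaF X J [set w | hits A i w = v].
Proof.
exact: (@measurable_hits _ (g_sigma_algebraType
  [set E | exists (s : dsub n d) (A : set T),
        (val s \subset J) /\ measurable A /\ E = X s @^-1` A])).
Qed.

(** Sets whose preimage under w -> (X s w)_s is measurable form a sigma-algebra containing the
    cylinders. *)
Lemma prod_measurable_comp (I : Type) {dO dT} {O : measurableType dO} {T : measurableType dT}
    {R : realType} (X : I -> O -> T) (f : (I -> T) -> R) :
  (forall s, measurable_fun setT (X s)) -> prod_measurable f ->
  measurable_fun setT (fun w => f (fun s => X s w)).
Proof.
move=> mX mf _ B mB; rewrite setTI.
pose F w s := X s w.
have H : @prod_sigma I dT T `<=` image_set_system setT F measurable.
  apply: smallest_sub; first exact/sigma_algebra_image/sigma_algebra_measurable.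
  move=> E [i [A [mA ->]]]; rewrite /image_set_system /=.
  exact: mX.
by have := H _ (mf B mB); rewrite /image_set_system /= setTI.
Qed.

Lemma card_ord_interval (n a k : nat) : (a + k <= n)%N ->
  #|finset (fun i : 'I_n => (a <= i < a + k)%N)| = k.
Proof.
move=> akn; have lt_n (j : 'I_k) : (a + j < n)%N by have := ltn_ord j; lia.
rewrite -[RHS](card_ord k) -(card_imset 'I_k (f := fun j => Ordinal (lt_n j))); last first.
  by move=> i j /(congr1 val) /= /addnI; exact: val_inj.
apply: eq_card => i; rewrite !inE; apply/idP/imsetP => [/andP[ai iak]|[j _ ->]] /=.
  have ik : (i - a < k)%N by lia.
  by exists (Ordinal ik) => //; apply: val_inj => /=; rewrite subnKC.
by rewrite leq_addr ltn_add2l ltn_ord.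
Qed.

Lemma fine_cov (R : realType) (x y w : \bar R) (b : R) :
  x \is a fin_num -> y \is a fin_num -> w \is a fin_num ->
  (`|x - y * w| <= b%:E)%E -> `|fine x - fine w * fine y| <= b.
Proof. by case: x y w => [x||] [y||] [w||] //= _ _ _; rewrite lee_fin (mulrC w). Qed.

Theorem theorem2p2 (R : realType) (dO : measure_display) (O : measurableType dO)
  (P : probability O R) (dT : measure_display) (T : measurableType dT)
  (d : nat) (p eps : R) (k l n : nat)
  (X : dsub n d -> O -> T) (f : (dsub n d -> T) -> R) :
  (0 < d)%N ->
  1 < p -> p <= 2 ->
  0 < eps -> eps <= 1 ->
  (d <= k)%N ->
  (l%:Z = Num.ceil (4 / (eps ^+ 4 * (p - 1)) * k%:R)) ->
  (l <= n)%N ->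
  (forall s, measurable_fun setT (X s)) ->
  dissociated P X ((eps / 10) `^ (10 / (p - 1))) l ->
  prod_measurable f ->
  (\int[P]_w (f (fun s => X s w))%:E = 0)%E ->
  Lnorm P p%:E (fun w => (f (fun s => X s w))%:E) = 1%E ->
  exists I : {set 'I_n}, interval_of_n I /\ (#|I| = k)%N /\
    forall J : {set 'I_n}, (J \subset I)%bool -> (d <= #|J|)%N ->
      forall Z : O -> R,
        cond_exp_version P (sigmaF X J) (fun w => f (fun s => X s w)) Z ->
        ((1 - eps)%:E <= P [set w | (`|Z w| <= eps)%R])%E.
Proof.
move=> d0 p1 p2 e0 e1 dk lE ln mX dis mf f0 fp.
set F := fun w => f (fun s => X s w).
have mF : measurable_fun setT F by exact: prod_measurable_comp.
have Fi := integrable_Lnorm1 P F p mF p1 fp.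
have F0 : \int[P]_x F x = 0 by rewrite /Rintegral f0.
set z := (p - 1)^-1.
have z1 : 1 <= z by rewrite /z invf_ge1; lra.
have e40 : 0 < eps ^+ 4 by rewrite exprn_gt0.
have e41 : eps ^+ 4 <= 1 by rewrite exprn_ile1// ltW.
have k0 : (0 < k)%N by exact: leq_trans dk.
have kR : 1 <= k%:R :> R by rewrite ler1n.
pose m := (l %/ k)%N.
(* Rounding l up and l/k down leaves m strictly between y - 1 and y + 1. Since y >= 4, m lies
   between 3y/4 and 5y/4, and y eps^4 = 4z. *)
have [mlo mhi] : 3 * z <= m%:R * eps ^+ 4 /\ m%:R * eps ^+ 4 <= 5 * z.
  set y := 4 / (eps ^+ 4 * (p - 1)).
  have ye : y * eps ^+ 4 = 4 * z by rewrite /y /z; field; rewrite !gt_eqF//; lra.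
  have y4 : 4 <= y by rewrite -(ler_pM2r e40) ye; nra.
  have [llo lhi] : y * k%:R <= l%:R /\ l%:R < y * k%:R + 1.
    have -> : l%:R = (Num.ceil (y * k%:R))%:~R :> R by rewrite -lE.
    split; first exact: ceil_ge.
    by have := ceilB1_lt (y * k%:R); rewrite intrB; lra.
  have mkl : m%:R * k%:R <= l%:R :> R by rewrite -natrM ler_nat leq_divM.
  have lmk : l%:R < (m%:R + 1) * k%:R :> R.
    by rewrite natr1 -natrM ltr_nat /m ltn_ceil.
  split.
    have : y < m%:R + 1 by rewrite -(ltr_pM2r (_ : 0 < k%:R)); lra.
    have : 0 <= (m%:R - 3 / 4 * y) * eps ^+ 4 -> 3 * z <= m%:R * eps ^+ 4 by lra.
    by move=> + ym; apply; rewrite mulr_ge0 ?(ltW e40)//; lra.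
  have : m%:R < y + 1.
    by rewrite -(ltr_pM2r (_ : 0 < k%:R)); lra.
  have : 0 <= (5 / 4 * y - m%:R) * eps ^+ 4 -> m%:R * eps ^+ 4 <= 5 * z by lra.
  by move=> + ym; apply; rewrite mulr_ge0 ?(ltW e40)//; lra.
have mk : (m * k <= n)%N by exact: leq_trans (leq_divM _ _) ln.
apply: contrapT => noI.
pose block i : {set 'I_n} := finset (fun a : 'I_n => (i * k <= a < i * k + k)%N).
(* The condition i < m sits under the existential so that [choice] yields a total function. The
   witness is {Z > 0} for a failing version Z with J inside block i. *)
have bad i : exists A : set O, (i < m)%N ->
    sigmaF X (block i) A /\ eps ^+ 2 / 2 < \int[P]_(x in A) F x.
  have [im|] := ltnP i m; last by exists set0.
  apply: contrapT => noA; apply: noI; exists (block i).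
  have card_b : #|block i| = k by apply: card_ord_interval; nia.
  split; first by exists (i * k)%N; rewrite card_b.
  split=> // J Jb dJ Z [Zm [Zi Zint]]; rewrite leNgt; apply/negP => PZ.
  apply: noA; exists [set w | 0 < Z w] => _.
  have ZA : sigmaF X J [set w | 0 < Z w].
    rewrite (_ : [set w | _] = Z @^-1` `]0, +oo[); first exact: Zm.
    by apply/seteqP; split => w /=; rewrite in_itv/= andbT.
  split; first exact: sub_sigmaF Jb _ ZA.
  have -> : \int[P]_(x in [set w | 0 < Z w]) F x = \int[P]_(x in [set w | 0 < Z w]) Z x.
    by rewrite /Rintegral Zint.
  apply: Rintegral_pos_lower => //.
  (* The whole space belongs to the generated sigma-algebra, so Z inherits mean zero from F. *)
  rewrite /Rintegral Zint ?f0//.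
  have := @measurableT _ (g_sigma_algebraType [set E | exists (s : dsub n d) (A : set T),
        (val s \subset J) /\ measurable A /\ E = X s @^-1` A]).
  exact.
have /choice[A' A'P] := bad.
(* The empty default makes every A_i measurable, including those beyond m. *)
pose A i := if (i < m)%N then A' i else set0.
have AP i : (i < m)%N -> sigmaF X (block i) (A i) /\ eps ^+ 2 / 2 < \int[P]_(x in A i) F x.
  by move=> im; rewrite /A im; exact: A'P.
have mA i : measurable (A i).
  have [im|im] := ltnP i m; last by rewrite /A ltnNge im; exact: measurable0.
  exact: (sigmaF_measurable n d X (block i)) (proj1 (AP i im)).
apply: (mixing_events_contradiction P F A m p eps) => //; last first.
  by move=> i im; exact: (proj2 (AP i im)).
move=> i v im.
(* For i = 0 the past is empty, too small for dissociation, but N_0 is constant and the covariance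
   is zero. *)
have [i0|i0] := posnP i.
  have [->|v0] := eqVneq v 0%N.
    rewrite (_ : [set w | _] = setT) ?setTI ?probability_setT ?mulr1 ?subrr ?normr0 ?powR_ge0//.
    by apply/seteqP; split => w //= _; rewrite i0 /hits big_ord0.
  rewrite (_ : [set w | _] = set0) ?set0I ?measure0 ?mulr0 ?subrr ?normr0 ?powR_ge0//.
  apply/seteqP; split => w //=.
  by rewrite i0 /hits big_ord0 => /esym/eqP; rewrite (negbTE v0).
(* U is the union of the first i blocks; together with block i it has (i + 1) k <= m k <= l
   elements, as dissociation requires. *)
pose U : {set 'I_n} := finset (fun a : 'I_n => (0 <= a < 0 + i * k)%N).
have card_U : #|U| = (i * k)%N by apply: card_ord_interval; nia.
have card_b : #|block i| = k by apply: card_ord_interval; nia.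
have sN : sigmaF X U [set w | hits A i w = v].
  apply: sigmaF_hits => j ji; apply: sub_sigmaF (proj1 (AP j (ltn_trans ji im))).
  by apply/fintype.subsetP => a; rewrite !inE /=; nia.
have mN : measurable [set w | hits A i w = v] by apply: measurable_hits.
have := dis U (block i) _ _ _ _ _ _ sN (proj1 (AP i im)).
rewrite card_U card_b => /(_ _ dk _ _).
move=> mix; apply: fine_cov; rewrite ?fin_num_measure//; first exact: measurableI.
apply: mix.
- by rewrite (leq_trans dk)// leq_pmull.
- by have := leq_divM l k; rewrite -/m; nia.
- by move=> a b; rewrite !inE /=; lia.
Qed.
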